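(* Let $\mathbf{a}_1,\ldots,\mathbf{a}_m\in\mathbb{C}^d$, let $\mathcal{A}(X)=(\mathbf{a}_1^*X\mathbf{a}_1,\ldots,\mathbf{a}_m^*X\mathbf{a}_m)$, and let $\mathbf{b}=\mathcal{A}(\mathbf{x}_0\mathbf{x}_0^* )+\mathbf{w}$, where $\mathbf{x}_0\in\mathbb{C}^d$ and $\mathbf{w}\in\mathbb{R}^m$. Let $X^\#$ be a global minimizer of $$\min_{X\in\mathbb{C}^{d\times d},\ X\succeq 0}\ \lambda\big(\mathrm{Tr}(X)-\|X\|_F\big)+\mu\|X\|_1+\frac12\|\mathcal{A}(X)-\mathbf{b}\|_2^2 .$$ If $\frac12\|\mathbf{b}\|_2^2>\mu\|\mathbf{x}_0\|_1^2+\frac12\|\mathbf{w}\|_2^2$, $\mu\ge 0$ and $$\lambda>\frac{\mu d+\|\mathcal{A}\|\big(\sqrt{2\mu}\,\|\mathbf{x}_0\|_1+\|\mathbf{w}\|_2\big)}{\sqrt2-1},$$ then $\mathrm{rank}(X^\#)=1$.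
   Context: For $X\in\mathbb{C}^{d\times d}$: $\|X\|_1=\sum_{i,j}|X_{i,j}|$ is the entrywise $\ell_1$ norm, $\|X\|_F$ is the Frobenius norm, and $X\succeq 0$ means that $X$ is Hermitian positive semidefinite. For a vector $\mathbf{x}$, $\|\mathbf{x}\|_1$ and $\|\mathbf{x}\|_2$ are the $\ell_1$ and $\ell_2$ norms. $\|\mathcal{A}\|$ is the operator norm $\sup\{\|\mathcal{A}(X)\|_2: X\in\mathbb{C}^{d\times d},\ \|X\|_F=1\}$. On Hermitian matrices $\mathcal{A}$ takes values in $\mathbb{R}^m$. *)

(* Defs.v *)
From HB Require Import structures.
From mathcomp Require Import all_boot all_order all_algebra.
From mathcomp Require Import complex.
From mathcomp Require Import boolp classical_sets reals.

Set Implicit Arguments.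
Unset Strict Implicit.
Unset Printing Implicit Defensive.

Import Order.TTheory GRing.Theory Num.Theory.
Local Open Scope ring_scope.
Local Open Scope sesquilinear_scope.
Local Open Scope classical_set_scope.
Local Open Scope complex_scope.

(* [normc] is the modulus as an element of R, whereas the generic norm on R[i]
   takes its values in R[i]. *)
Notation modulus := ComplexField.Normc.normc (only parsing).

Definition l1norm (R : realType) (m n : nat) (A : 'M[R[i]]_(m, n)) : R :=
  \sum_i \sum_j modulus (A i j).

(* The Frobenius norm; on column vectors, the Euclidean norm. *)
Definition l2norm (R : realType) (m n : nat) (A : 'M[R[i]]_(m, n)) : R :=
  Num.sqrt (\sum_i \sum_j modulus (A i j) ^+ 2).

(* In R[i], [0 <= z] means that z is real and nonnegative. *)
Definition psdmx (R : realType) (d : nat) (X : 'M[R[i]]_d) : Prop :=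
  X \is hermsymmx /\ forall v : 'cV[R[i]]_d, 0 <= (v^t* *m X *m v) 0 0.

Definition quad_meas (R : realType) (d m : nat) (a : 'I_m -> 'cV[R[i]]_d)
    (X : 'M[R[i]]_d) : 'cV[R[i]]_m :=
  \col_k ((a k)^t* *m X *m a k) 0 0.

(* The set is bounded above for a linear f, and nonempty unless d = 0, in which
   case [sup] is 0. *)
Definition opnorm (R : realType) (d m : nat)
    (f : 'M[R[i]]_d -> 'cV[R[i]]_m) : R :=
  sup [set l2norm (f X) | X in [set X : 'M[R[i]]_d | l2norm X = 1]].

(* [\tr X] lives in R[i]; it is real on the feasible (Hermitian) matrices, which
   is where the objective is minimized. *)
Definition objective (R : realType) (d m : nat) (a : 'I_m -> 'cV[R[i]]_d)
    (b : 'cV[R[i]]_m) (lambda mu : R) (X : 'M[R[i]]_d) : R :=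
  lambda * (complex.Re (\tr X) - l2norm X) + mu * l1norm X
  + 2^-1 * l2norm (quad_meas a X - b) ^+ 2.

Definition global_minimizer (R : realType) (d m : nat)
    (a : 'I_m -> 'cV[R[i]]_d) (b : 'cV[R[i]]_m) (lambda mu : R)
    (X : 'M[R[i]]_d) : Prop :=
  psdmx X /\
  forall Y : 'M[R[i]]_d, psdmx Y ->
    objective a b lambda mu X <= objective a b lambda mu Y.

(* Main.v *)
(* Let [F] be the Frobenius norm of the minimizer [X] and [P] the orthogonal
   projector onto its range. Comparing the objective at [X] with its values at
   [x0 x0*] and at [0] bounds the residual and shows [X <> 0]. Put
   [H = P - X / F]: for small [t > 0] the matrix [X - t H] is still feasible,
   and since [Tr H - <X, H> / F] is the squared Frobenius norm of [H], minimality of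
   [X] gives [lambda * |H| <= mu * d + opnorm A * |A X - b|]. If [X] has rank
   [r], Cauchy-Schwarz gives [|H|^2 = r - 2 Tr X / F + 1 >= (sqrt r - 1)^2], so
   [r >= 2] would force [lambda] below the assumed bound. *)
Require Import Defs.
From HB Require Import structures.
From mathcomp Require Import all_boot all_order all_algebra.
From mathcomp Require Import complex ring lra.
From mathcomp Require Import boolp classical_sets reals.

Set Implicit Arguments.
Unset Strict Implicit.
Unset Printing Implicit Defensive.

Import Order.TTheory GRing.Theory Num.Theory.
Local Open Scope ring_scope.
Local Open Scope sesquilinear_scope.
Local Open Scope complex_scope.

(** * Cauchy-Schwarz for finite sums, and the complex modulus *)

Lemma sum_cauchy_schwarz (R : realDomainType) (I : finType) (f g : I -> R) :
  (\sum_i f i * g i) ^+ 2 <= (\sum_i f i ^+ 2) * (\sum_i g i ^+ 2).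
Proof.
(* Lagrange's identity writes the defect in Cauchy-Schwarz as a sum of squares, without roots or
   division. *)
have lagrange : \sum_i \sum_j (f i * g j - f j * g i) ^+ 2 =
    2 * ((\sum_i f i ^+ 2) * (\sum_i g i ^+ 2) - (\sum_i f i * g i) ^+ 2).
  transitivity (\sum_i \sum_j (f i ^+ 2 * g j ^+ 2)
    + \sum_i \sum_j (g i ^+ 2 * f j ^+ 2)
    - 2 * (\sum_i \sum_j (f i * g i) * (f j * g j))).
    rewrite mulr_sumr -big_split -sumrB; apply: eq_bigr => i _ /=.
    rewrite mulr_sumr -big_split -sumrB; apply: eq_bigr => j _ /=.
    by ring.
  by rewrite -!big_distrlr /=; ring.
have : 0 <= \sum_i \sum_j (f i * g j - f j * g i) ^+ 2.
  by apply: sumr_ge0 => i _; apply: sumr_ge0 => j _; apply: sqr_ge0.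
by rewrite lagrange pmulr_rge0 ?ltr0n // subr_ge0.
Qed.

Lemma modulus_ge0 (R : rcfType) (z : R[i]) : 0 <= modulus z.
Proof. by case: z => x y; apply: sqrtr_ge0. Qed.

Lemma modulus_sqrE (R : rcfType) (z : R[i]) :
  (modulus z ^+ 2)%:C = Num.conj z * z.
Proof. by rewrite rmorphXn mulrC -normCK. Qed.

Lemma modulus_sum (R : rcfType) (I : finType) (z : I -> R[i]) :
  modulus (\sum_i z i) <= \sum_i modulus (z i).
Proof.
elim/big_ind2: _ => [|x1 x2 y1 y2 H1 H2|i _] //.
  by rewrite ComplexField.Normc.normc0.
by apply: le_trans (le_normcD _ _) _; apply: lerD.
Qed.

Lemma modulus_real (R : rcfType) (x : R) : 0 <= x -> modulus x%:C = x.
Proof. by move=> x0; rewrite /= expr0n /= addr0 sqrtr_sqr ger0_norm. Qed.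

(** * Entrywise l1 and Frobenius norms, outer products *)

Section Norms.
Context (R : realType).

Lemma l2norm_ge0 m n (A : 'M[R[i]]_(m, n)) : 0 <= l2norm A.
Proof. exact: sqrtr_ge0. Qed.

Lemma l2norm_sqr m n (A : 'M[R[i]]_(m, n)) :
  l2norm A ^+ 2 = \sum_i \sum_j modulus (A i j) ^+ 2.
Proof.
rewrite sqr_sqrtr //.
by apply: sumr_ge0 => i _; apply: sumr_ge0 => j _; apply: sqr_ge0.
Qed.

Lemma l2norm_trmxC_mul m n (A : 'M[R[i]]_(m, n)) :
  (l2norm A ^+ 2)%:C = \tr (A^t* *m A).
Proof.
rewrite l2norm_sqr exchange_big rmorph_sum; apply: eq_bigr => j _ /=.
rewrite rmorph_sum mxE; apply: eq_bigr => i _ /=.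
by rewrite !mxE modulus_sqrE.
Qed.

Lemma l2norm_triangle m n (A B : 'M[R[i]]_(m, n)) :
  l2norm (A + B) <= l2norm A + l2norm B.
Proof.
rewrite -(@ler_pXn2r _ 2) ?nnegrE ?addr_ge0 ?l2norm_ge0 //.
set p := fun (C : 'M[R[i]]_(m, n)) (ij : 'I_m * 'I_n) => modulus (C ij.1 ij.2).
have sqE C : l2norm C ^+ 2 = \sum_ij p C ij ^+ 2.
  by rewrite l2norm_sqr pair_big.
have cs : \sum_ij p A ij * p B ij <= l2norm A * l2norm B.
  rewrite -(@ler_pXn2r _ 2) ?nnegrE ?mulr_ge0 ?l2norm_ge0 //; last first.
    by apply: sumr_ge0 => i _; rewrite mulr_ge0 ?modulus_ge0.
  by rewrite exprMn !sqE sum_cauchy_schwarz.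
rewrite sqrrD; apply: (@le_trans _ _ (\sum_ij (p A ij + p B ij) ^+ 2)).
  rewrite sqE; apply: ler_sum => ij _; rewrite /p mxE.
  by rewrite ler_pXn2r ?nnegrE ?addr_ge0 ?modulus_ge0 // le_normcD.
under eq_bigr do rewrite sqrrD mulr2n.
rewrite !big_split /= -!sqE.
by lra.
Qed.

Lemma l2normZ m n (c : R[i]) (A : 'M[R[i]]_(m, n)) :
  l2norm (c *: A) = modulus c * l2norm A.
Proof.
apply/eqP; rewrite -(@eqrXn2 _ 2) ?mulr_ge0 ?l2norm_ge0 ?modulus_ge0 //.
rewrite exprMn !l2norm_sqr mulr_sumr; apply/eqP/eq_bigr => i _.
rewrite mulr_sumr; apply: eq_bigr => j _.
by rewrite mxE ComplexField.Normc.normcM exprMn.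
Qed.

Lemma l2norm_eq0 m n (A : 'M[R[i]]_(m, n)) : l2norm A = 0 -> A = 0.
Proof.
move/(congr1 (fun x => x ^+ 2)); rewrite l2norm_sqr expr0n /= pair_big /= => /eqP.
rewrite psumr_eq0 => [/allP A0|ij _]; last exact: sqr_ge0.
apply/matrixP => i j; rewrite mxE; apply: ComplexField.Normc.eq0_normc.
have /= := A0 (i, j); rewrite mem_index_enum sqrf_eq0 => /(_ isT)/eqP.
by [].
Qed.

Lemma modulus_le_l2norm m n (A : 'M[R[i]]_(m, n)) i j :
  modulus (A i j) <= l2norm A.
Proof.
rewrite -(@ler_pXn2r _ 2) ?nnegrE ?l2norm_ge0 ?modulus_ge0 //.
rewrite l2norm_sqr pair_big /= (bigD1 (i, j)) //= lerDl.
by apply: sumr_ge0 => *; apply: sqr_ge0.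
Qed.

Lemma l1norm_ge0 m n (A : 'M[R[i]]_(m, n)) : 0 <= l1norm A.
Proof. by apply: sumr_ge0 => i _; apply: sumr_ge0 => j _; apply: modulus_ge0. Qed.

Lemma l1norm_triangle m n (A B : 'M[R[i]]_(m, n)) :
  l1norm (A + B) <= l1norm A + l1norm B.
Proof.
rewrite /l1norm -big_split; apply: ler_sum => i _ /=.
by rewrite -big_split; apply: ler_sum => j _ /=; rewrite mxE le_normcD.
Qed.

Lemma l1normZ m n (c : R[i]) (A : 'M[R[i]]_(m, n)) :
  l1norm (c *: A) = modulus c * l1norm A.
Proof.
rewrite /l1norm mulr_sumr; apply: eq_bigr => i _; rewrite mulr_sumr.
by apply: eq_bigr => j _; rewrite mxE ComplexField.Normc.normcM.
Qed.

(** Cauchy-Schwarz against the all-ones matrix, whose Frobenius norm is [d]; this is the source of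
    the term [mu * d] in the bound on [lambda]. *)
Lemma l1norm_le_l2norm d (A : 'M[R[i]]_d) : l1norm A <= d%:R * l2norm A.
Proof.
rewrite -(@ler_pXn2r _ 2) ?nnegrE ?mulr_ge0 ?l2norm_ge0 ?l1norm_ge0 //.
rewrite exprMn l2norm_sqr /l1norm !pair_big /=.
have /= := @sum_cauchy_schwarz R _ (fun=> 1)
  (fun ij : 'I_d * 'I_d => modulus (A ij.1 ij.2)).
under eq_bigr do rewrite mul1r.
by rewrite expr1n sumr_const card_prod card_ord natrM -expr2.
Qed.

Lemma l1norm_outer d (x : 'cV[R[i]]_d) : l1norm (x *m x^t*) = l1norm x ^+ 2.
Proof.
rewrite /l1norm; under [in RHS]eq_bigr do rewrite big_ord1.
rewrite expr2 big_distrlr; apply: eq_bigr => i _; apply: eq_bigr => j _.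
rewrite mxE big_ord1 !mxE ComplexField.Normc.normcM; congr (_ * _).
by apply: complexI; have := norm_conjC (x j 0).
Qed.

Lemma tr_outer d (x : 'cV[R[i]]_d) : complex.Re (\tr (x *m x^t*)) = l2norm x ^+ 2.
Proof. by rewrite mxtrace_mulC -l2norm_trmxC_mul. Qed.

Lemma l2norm_outer d (x : 'cV[R[i]]_d) : l2norm (x *m x^t*) = l2norm x ^+ 2.
Proof.
apply/eqP; rewrite -(@eqrXn2 _ 2) ?exprn_ge0 ?l2norm_ge0 //; apply/eqP.
rewrite !l2norm_sqr.
under [in RHS]eq_bigr do rewrite big_ord1.
rewrite expr2 big_distrlr; apply: eq_bigr => i _; apply: eq_bigr => j _.
rewrite mxE big_ord1 !mxE ComplexField.Normc.normcM exprMn; congr (_ * _ ^+ 2).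
by apply: complexI; have := norm_conjC (x j 0).
Qed.

Lemma psd_outer d (x : 'cV[R[i]]_d) : psdmx (x *m x^t*).
Proof.
split.
  apply/is_hermitianmxP; rewrite expr0 scale1r; apply/matrixP => i j.
  by rewrite !mxE !big_ord1 !mxE rmorphM /= conjCK mulrC.
move=> v; rewrite mulmxA -mulmxA mxE big_ord1.
(* The quadratic form at [v] is then z times its conjugate, with z = v* x. *)
have -> : (x^t* *m v) 0 0 = Num.conj ((v^t* *m x) 0 0).
  rewrite !mxE rmorph_sum; apply: eq_bigr => i _.
  by rewrite !mxE rmorphM /= conjCK mulrC.
exact: mul_conjC_ge0.
Qed.

(** * Quadratic measurements and their operator norm *)

Lemma quad_measB d m (a : 'I_m -> 'cV[R[i]]_d) (A B : 'M[R[i]]_d) :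
  quad_meas a (A - B) = quad_meas a A - quad_meas a B.
Proof. by apply/colP => k; rewrite [LHS]mxE mulmxBr mulmxBl !mxE. Qed.

Lemma quad_measZ d m (a : 'I_m -> 'cV[R[i]]_d) c (A : 'M[R[i]]_d) :
  quad_meas a (c *: A) = c *: quad_meas a A.
Proof. by apply/colP => k; rewrite [LHS]mxE -scalemxAr -scalemxAl !mxE. Qed.

(** A crude bound that makes the supremum in [opnorm] a genuine upper bound: each entry of [A] has
    modulus at most 1, so |a* A a| is at most the square of the l1 norm of a. *)
Lemma quad_meas_bounded d m (a : 'I_m -> 'cV[R[i]]_d) (A : 'M[R[i]]_d) :
  l2norm A = 1 ->
  l2norm (quad_meas a A) <= Num.sqrt (\sum_k l1norm (a k) ^+ 4).
Proof.
move=> A1; rewrite /l2norm ler_sqrt; last first.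
  by apply: sumr_ge0 => k _; rewrite exprn_ge0 ?l1norm_ge0.
apply: ler_sum => k _; rewrite big_ord1 (exprM _ 2 2).
rewrite ler_pXn2r ?nnegrE ?exprn_ge0 ?l1norm_ge0 ?modulus_ge0 //.
rewrite mxE -l1norm_outer mxE; apply: le_trans (modulus_sum _) _.
rewrite /l1norm; apply: ler_sum => i _.
rewrite mxE mulr_suml; apply: le_trans (modulus_sum _) _.
apply: ler_sum => j _; rewrite !mxE big_ord1 !mxE !ComplexField.Normc.normcM.
rewrite mulrC mulrA ler_piMr ?mulr_ge0 ?modulus_ge0 //.
by rewrite -A1 modulus_le_l2norm.
Qed.

Lemma quad_meas_le_opnorm d m (a : 'I_m -> 'cV[R[i]]_d) (A : 'M[R[i]]_d) :
  l2norm (quad_meas a A) <= opnorm (quad_meas a) * l2norm A.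
Proof.
have [/l2norm_eq0 ->|A0] := eqVneq (l2norm A) 0.
  rewrite -(scale0r 0) quad_measZ !l2normZ.
  by rewrite ComplexField.Normc.normc0 !mul0r mulr0.
have Agt0 : 0 < l2norm A by rewrite lt_def A0 l2norm_ge0.
rewrite -ler_pdivrMr // mulrC.
rewrite -(@modulus_real _ (l2norm A)^-1) ?invr_ge0 ?l2norm_ge0 //.
rewrite -l2normZ -quad_measZ; apply: ub_le_sup.
  exists (Num.sqrt (\sum_k l1norm (a k) ^+ 4)) => _ [B B1 <-].
  exact: quad_meas_bounded.
exists ((l2norm A)^-1%:C *: A) => //=.
by rewrite l2normZ modulus_real ?invr_ge0 ?l2norm_ge0 // mulVf.
Qed.

Lemma opnorm_ge0 d m (f : 'M[R[i]]_d -> 'cV[R[i]]_m) : 0 <= opnorm f.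
Proof.
rewrite /opnorm; set E := (E in sup E).
(* Without a supremum, [sup] takes the default value 0; otherwise it lies above some norm. *)
have [supE|/sup_out -> //] := pselect (has_sup E).
have [[y Ey] _] := supE; apply: le_trans (sup_upper_bound supE Ey).
by have [A _ <-] := Ey; apply: l2norm_ge0.
Qed.

End Norms.

(** * Unitary diagonalization and the spectral decomposition *)

Section UnitaryDiagonal.
Context (C : numClosedFieldType) (d : nat).
Implicit Types (U : 'M[C]_d) (v : 'rV[C]_d).

(** The eigenvectors are the columns of U*, following the convention of [spectralmx]. *)
Definition unitary_diag U v : 'M[C]_d := U^t* *m diag_mx v *m U.

Lemma unitary_diagB U v1 v2 :
  unitary_diag U (v1 - v2) = unitary_diag U v1 - unitary_diag U v2.
Proof. by rewrite /unitary_diag linearB /= mulmxBr mulmxBl. Qed.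

Lemma unitary_diagZ U c v : unitary_diag U (c *: v) = c *: unitary_diag U v.
Proof. by rewrite /unitary_diag linearZ /= -scalemxAr -scalemxAl. Qed.

Lemma unitary_diag_trmxC U v :
  v \is a realmx -> (unitary_diag U v)^t* = unitary_diag U v.
Proof.
move=> v_real; rewrite /unitary_diag !trmx_mul !map_mxM trmxCK tr_diag_mx.
by rewrite map_diag_mx (realmxC v_real) mulmxA.
Qed.

Lemma unitary_diag_ge0 U v (x : 'cV[C]_d) :
  (forall i, 0 <= v 0 i) -> 0 <= (x^t* *m unitary_diag U v *m x) 0 0.
Proof.
move=> v_ge0; rewrite /unitary_diag !mulmxA.
have -> : x^t* *m U^t* = (U *m x)^t* by rewrite trmx_mul map_mxM.
rewrite -mulmxA mul_mx_diag mxE; apply: sumr_ge0 => j _.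
by rewrite !mxE mulrAC mulr_ge0 // mulrC mul_conjC_ge0.
Qed.

(** Products with U and U* cannot raise the rank, and [diag_mx v] is a sum of multiples of matrix
    units, one of rank at most 1 for each nonzero weight. *)
Lemma rank_unitary_diag U v :
  (\rank (unitary_diag U v) <= \sum_i (v ord0 i != 0%R))%N.
Proof.
apply: leq_trans (mxrankM_maxl _ _) _; apply: leq_trans (mxrankM_maxr _ _) _.
have -> : diag_mx v = \sum_i v 0 i *: delta_mx i i.
  apply/matrixP => i j; rewrite summxE (bigD1 i) //= big1 => [|k ki].
    by rewrite !mxE eqxx addr0 /= eq_sym; case: eqP; rewrite ?mulr1 ?mulr0.
  by rewrite !mxE eq_sym (negPf ki) mulr0.
elim/big_ind2: _ => [|A k B l Ak Bl|i _]; first by rewrite mxrank0.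
  by apply: leq_trans (mxrank_add _ _) _; apply: leq_add.
have [->|_] := eqVneq (v 0 i) 0; first by rewrite scale0r mxrank0.
by apply: leq_trans (mxrank_scale _ _) _; rewrite mxrank_delta.
Qed.

Lemma tr_unitary_diag U v :
  U \is unitarymx -> \tr (unitary_diag U v) = \sum_i v 0 i.
Proof.
move=> /unitarymxP UU; rewrite /unitary_diag mxtrace_mulC mulmxA UU mul1mx.
exact: mxtrace_diag.
Qed.

Lemma tr_unitary_diag_sqr U v :
  U \is unitarymx ->
  \tr (unitary_diag U v *m unitary_diag U v) = \sum_i v 0 i ^+ 2.
Proof.
move=> UU; have -> : unitary_diag U v *m unitary_diag U v =
    unitary_diag U (\row_i (v 0 i * v 0 i)).
  rewrite /unitary_diag -mulmx_diag !mulmxA -[_ *m U *m U^t*]mulmxA.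
  by rewrite (unitarymxP UU) mulmx1.
by rewrite tr_unitary_diag //; apply: eq_bigr => i _; rewrite mxE.
Qed.

(** The quadratic form at the i-th eigenvector recovers the i-th eigenvalue; semidefiniteness
    thereby gives the sign of the eigenvalues. *)
Lemma unitary_diag_diag U v i :
  U \is unitarymx ->
  let x := U^t* *m delta_mx i 0 : 'cV_d in
  (x^t* *m unitary_diag U v *m x) 0 0 = v 0 i.
Proof.
move=> /unitarymxP UU; rewrite /= /unitary_diag trmx_mul map_mxM trmxCK !mulmxA.
rewrite -[_ *m U *m _^t*]mulmxA UU mulmx1.
rewrite -[_ *m U *m _^t*]mulmxA UU mulmx1.
by rewrite trmx_delta map_delta_mx -rowE -colE !mxE eqxx mulr1n.
Qed.

Lemma hermsymmx_unitary_diag (X : 'M[C]_d) : X \is hermsymmx ->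
  X = unitary_diag (spectralmx X) (spectral_diag X).
Proof.
move=> /hermitian_normalmx/orthomx_spectralP {1}->.
by rewrite invmx_unitary // spectral_unitarymx.
Qed.

End UnitaryDiagonal.

(** Real weights keep all eigenvalue computations in the ordered field [R]. *)
Definition spectral_sum (R : realType) d (U : 'M[R[i]]_d) (s : 'rV[R]_d) :
  'M[R[i]]_d := unitary_diag U (map_mx (real_complex R) s).

Section SpectralSum.
Context (R : realType) (d : nat) (U : 'M[R[i]]_d).
Implicit Type s : 'rV[R]_d.

Lemma spectral_sumB s1 s2 :
  spectral_sum U (s1 - s2) = spectral_sum U s1 - spectral_sum U s2.
Proof. by rewrite -unitary_diagB -map_mxB. Qed.

Lemma spectral_sumZ c s : spectral_sum U (c *: s) = c%:C *: spectral_sum U s.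
Proof. by rewrite -unitary_diagZ -map_mxZ. Qed.

Lemma spectral_sum_trmxC s : (spectral_sum U s)^t* = spectral_sum U s.
Proof.
by apply: unitary_diag_trmxC; apply/mxOverP => i j; rewrite mxE complex_real.
Qed.

Lemma psd_spectral_sum s :
  (forall i, 0 <= s 0 i) -> psdmx (spectral_sum U s).
Proof.
move=> s_ge0; split.
  by apply/is_hermitianmxP; rewrite expr0 scale1r spectral_sum_trmxC.
by move=> v; apply: unitary_diag_ge0 => i; rewrite mxE ler0c.
Qed.

Lemma rank_spectral_sum s :
  (\rank (spectral_sum U s) <= \sum_i (s ord0 i != 0%R))%N.
Proof.
apply: leq_trans (rank_unitary_diag _ _) _; apply: leq_sum => i _.
by rewrite mxE fmorph_eq0.
Qed.

Hypothesis U_unitary : U \is unitarymx.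

Lemma tr_spectral_sum s : \tr (spectral_sum U s) = (\sum_i s 0 i)%:C.
Proof.
by rewrite tr_unitary_diag // rmorph_sum; apply: eq_bigr => i _; rewrite mxE.
Qed.

Lemma l2norm_spectral_sum s :
  l2norm (spectral_sum U s) ^+ 2 = \sum_i s 0 i ^+ 2.
Proof.
apply: complexI; rewrite l2norm_trmxC_mul spectral_sum_trmxC.
rewrite tr_unitary_diag_sqr // rmorph_sum.
by apply: eq_bigr => i _; rewrite mxE rmorphXn.
Qed.

End SpectralSum.

Lemma psd_spectral_decomposition (R : realType) d (X : 'M[R[i]]_d) :
  psdmx X -> exists U, exists s : 'rV[R]_d,
    [/\ U \is unitarymx, forall i, 0 <= s 0 i & X = spectral_sum U s].
Proof.
case=> X_herm X_ge0; have XE := hermsymmx_unitary_diag X_herm.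
(* A Hermitian matrix has real eigenvalues, so taking real parts loses nothing. *)
have vE : spectral_diag X =
    map_mx (real_complex R) (map_mx (@complex.Re R) (spectral_diag X)).
  apply/rowP => i; rewrite !mxE RRe_real //.
  exact: (mxOverP (hermitian_spectral_diag_real X_herm)).
exists (spectralmx X), (map_mx (@complex.Re R) (spectral_diag X)); split.
- exact: spectral_unitarymx.
- move=> i; rewrite -ler0c.
  have := X_ge0 ((spectralmx X)^t* *m delta_mx i 0).
  rewrite {2}XE unitary_diag_diag ?spectral_unitarymx // => v_ge0.
  by move/rowP: vE => /(_ i); rewrite [RHS]mxE => <-.
- by rewrite /spectral_sum -vE.
Qed.

(** * First-order comparison and the descent direction *)

Lemma le_of_le_add_small (R : realFieldType) (x y c t0 : R) :
  0 < t0 -> 0 <= c ->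
  (forall t, 0 < t -> t <= t0 -> x <= y + t * c) -> x <= y.
Proof.
move=> t0_gt0 c_ge0 xy; rewrite leNgt; apply/negP => ltyx.
have c1 : 0 < c + 1 by lra.
(* This replaces a limit t -> 0. Dividing by [c + 1] is safe when [c = 0] and makes [t * c] strictly
   smaller than the gap [x - y]. *)
pose t := Num.min t0 ((x - y) / (c + 1)).
have t_gt0 : 0 < t by rewrite lt_min t0_gt0 divr_gt0 // subr_gt0.
have := xy t t_gt0; rewrite ge_min lexx => /(_ isT).
have : t * (c + 1) <= x - y by rewrite -ler_pdivlMr // ge_min lexx orbT.
by lra.
Qed.

(** Scalar bookkeeping for moving from X to X - t H. At X, [S], [F], [L], [r] are the trace,
    Frobenius norm, l1 norm and residual norm; [S'], [N], [L'], [Q] are the same at X - t H. For H,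
    [T], [l], [q] are the trace, l1 norm and measurement norm, and [G] is <X, H> / F. *)
Lemma first_order_comparison (R : realFieldType)
    (lambda mu t S S' T F G N L L' l r q Q x y : R) :
  x = lambda * (S - F) + mu * L + 2^-1 * r ^+ 2 ->
  y = lambda * (S' - N) + mu * L' + 2^-1 * Q ^+ 2 -> x <= y ->
  S' = S - t * T -> lambda * (F - t * G) <= lambda * N ->
  mu * L' <= mu * (L + t * l) -> Q ^+ 2 <= (r + t * q) ^+ 2 ->
  t * (lambda * (T - G)) <= t * (mu * l + r * q + t * (2^-1 * q ^+ 2)).
Proof. by move=> -> -> /[swap] ->; lra. Qed.

(* The direction [P - X / ||X||_F], with [P] the orthogonal projector onto the
   range of [X], in an eigenbasis of [X] with eigenvalues [s]. *)
Definition descent_weights (R : realType) d (s : 'rV[R]_d) (F : R) : 'rV[R]_d :=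
  \row_i ((s 0 i != 0)%:R - s 0 i / F).

Section DescentWeights.
Context (R : realType) (d : nat) (s : 'rV[R]_d) (F : R).
Hypotheses (F_gt0 : 0 < F) (FE : F ^+ 2 = \sum_i s 0 i ^+ 2).
Local Notation h := (descent_weights s F).
Local Notation k := (\sum_i (s ord0 i != 0%R))%N.

Lemma sum_sqr_descent_weights :
  \sum_i h 0 i ^+ 2 = k%:R - 2 * ((\sum_i s 0 i) / F) + 1.
Proof.
have F0 : F != 0 by rewrite gt_eqF.
(* The constant 1 is spread over the indices so that the identity can be checked term by term. *)
rewrite [X in _ + X](_ : 1 = \sum_i s 0 i ^+ 2 / F ^+ 2); last first.
  by rewrite -mulr_suml -FE divff // expf_neq0.
rewrite natr_sum mulr_suml mulr_sumr -sumrB -big_split; apply: eq_bigr => i _ /=.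
rewrite mxE; have [->|si0] := eqVneq (s 0 i) 0 => /=; first by rewrite !mul0r; ring.
by field.
Qed.

(** Termwise, h_i (1 - s_i / F) = h_i^2: on the support of [s] the second factor is h_i, and off it
    h_i = 0. *)
Lemma sum_descent_weights :
  \sum_i h 0 i - (\sum_i s 0 i * h 0 i) / F = \sum_i h 0 i ^+ 2.
Proof.
rewrite mulr_suml -sumrB; apply: eq_bigr => i _; rewrite mxE.
have [->|si0] := eqVneq (s 0 i) 0 => /=; first by rewrite !mul0r; ring.
have F0 : F != 0 by rewrite gt_eqF.
by field.
Qed.

Lemma sum_sqr_descent_weights_ge :
  (1 < k)%N -> Num.sqrt 2 - 1 <= Num.sqrt (\sum_i h 0 i ^+ 2).
Proof.
move=> k2; rewrite -[leLHS]ger0_norm; last first.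
  by rewrite subr_ge0 -{1}sqrtr1 ler_sqrt // ler1n.
(* Cauchy-Schwarz against the indicator of the support of [s], so that the constant involves the
   number [k] of nonzero eigenvalues and not [d]. *)
have sum_s : \sum_i s 0 i <= Num.sqrt k%:R * F.
  apply: le_trans (ler_norm _) _.
  rewrite -(@ler_pXn2r _ 2) ?nnegrE ?mulr_ge0 ?sqrtr_ge0 ?(ltW F_gt0) //.
  rewrite real_normK ?num_real // exprMn sqr_sqrtr // FE.
  have := sum_cauchy_schwarz (fun i => (s 0 i != 0)%:R) (fun i => s 0 i).
  congr (_ ^+ 2 <= _ * _).
    by apply: eq_bigr => i _; case: eqP => [->|_] /=; rewrite ?mulr0 ?mul1r.
  by rewrite natr_sum; apply: eq_bigr => i _; case: eqP; rewrite ?expr0n ?expr1n.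
rewrite -sqrtr_sqr ler_sqrt ?sumr_ge0 // => [|i _]; last exact: sqr_ge0.
(* The square of sqrt k - 1 increases with k >= 1, so k = 2 is the worst case. *)
apply: (@le_trans _ _ ((Num.sqrt k%:R - 1) ^+ 2)).
  rewrite ler_pXn2r ?nnegrE ?subr_ge0 ?lerD2r ?ler_sqrt ?ler_nat //.
    by rewrite -{1}sqrtr1 ler_sqrt // ler1n.
  by rewrite -{1}sqrtr1 ler_sqrt // ler1n ltnW.
rewrite sum_sqr_descent_weights sqrrB1 sqr_sqrtr //.
have : (\sum_i s 0 i) / F <= Num.sqrt k%:R by rewrite ler_pdivrMr.
by lra.
Qed.

Lemma descent_weights_feasible :
  (forall i, 0 <= s 0 i) -> exists2 t0 : R, 0 < t0 &
    forall t, 0 < t -> t <= t0 -> forall i, 0 <= (s - t *: h) 0 i.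
Proof.
(* The step is bounded by the least nonzero eigenvalue, capped at 1. On the support, s_i - t h_i =
   (s_i - t) + t s_i / F; off it nothing moves. *)
move=> s_ge0; exists (\big[Num.min/1]_(i | s 0 i != 0) s 0 i).
  by apply: lt_bigmin => [|i si0]; rewrite ?ltr01 // lt_def si0 s_ge0.
move=> t t_gt0 le_t i; rewrite !mxE.
have [->|si0] := eqVneq (s 0 i) 0 => /=; first by rewrite mul0r !subr0 mulr0 subr0.
have : t <= s 0 i by apply: le_trans le_t _; apply: bigmin_le_cond.
have : 0 <= t * (s 0 i / F) by rewrite mulr_ge0 ?divr_ge0 // ltW.
by lra.
Qed.

End DescentWeights.

(** * Optimality conditions at a minimizer *)

Section Minimizer.
Context (R : realType) (d m : nat) (a : 'I_m -> 'cV[R[i]]_d) (b : 'cV[R[i]]_m).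
Context (lambda mu : R) (mu_ge0 : 0 <= mu) (lambda_ge0 : 0 <= lambda).

(** For nonnegative eigenvalues, the square of the sum dominates the sum of squares; hence the
    trace-minus-Frobenius penalty is nonnegative on the cone. *)
Lemma l2norm_le_sum (U : 'M[R[i]]_d) (s : 'rV[R]_d) :
  U \is unitarymx -> (forall i, 0 <= s 0 i) ->
  l2norm (spectral_sum U s) <= \sum_i s 0 i.
Proof.
move=> U_unit s_ge0; have S_ge0 : 0 <= \sum_i s 0 i by apply: sumr_ge0.
rewrite -(@ler_pXn2r _ 2) ?nnegrE ?l2norm_ge0 // l2norm_spectral_sum //.
rewrite [leRHS]expr2 mulr_suml; apply: ler_sum => i _.
by rewrite expr2 ler_wpM2l // (bigD1 i) //= lerDl sumr_ge0.
Qed.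

Lemma objective_spectral_sum (U : 'M[R[i]]_d) (s : 'rV[R]_d)
    (X := spectral_sum U s) : U \is unitarymx ->
  objective a b lambda mu X =
  lambda * (\sum_i s 0 i - l2norm X) + mu * l1norm X
  + 2^-1 * l2norm (quad_meas a X - b) ^+ 2.
Proof. by move=> U_unit; rewrite /objective tr_spectral_sum. Qed.

Lemma residual_le_objective X : psdmx X ->
  2^-1 * l2norm (quad_meas a X - b) ^+ 2 <= objective a b lambda mu X.
Proof.
move=> /psd_spectral_decomposition[U [s [U_unit s_ge0 ->]]].
rewrite objective_spectral_sum // lerDr addr_ge0 ?mulr_ge0 ?l1norm_ge0 //.
by rewrite subr_ge0 l2norm_le_sum.
Qed.

Lemma spectral_sum_cauchy_schwarz (U : 'M[R[i]]_d) (s v : 'rV[R]_d) :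
  U \is unitarymx ->
  \sum_i s 0 i * v 0 i <= l2norm (spectral_sum U s) * l2norm (spectral_sum U v).
Proof.
move=> U_unit; have cs := sum_cauchy_schwarz (s 0) (v 0).
rewrite -(l2norm_spectral_sum U_unit s) in cs.
rewrite -(l2norm_spectral_sum U_unit v) -exprMn in cs.
apply: le_trans (ler_norm _) _.
rewrite -(@ler_pXn2r _ 2) ?nnegrE ?mulr_ge0 ?l2norm_ge0 //.
by rewrite real_normK ?num_real.
Qed.

(** First-order optimality along -H, a one-sided condition since feasibility of X - t H is known
    only for small t > 0. *)
Lemma stationarity (U : 'M[R[i]]_d) (s : 'rV[R]_d)
    (X := spectral_sum U s)
    (H := spectral_sum U (descent_weights s (l2norm X))) :
  U \is unitarymx -> (forall i, 0 <= s 0 i) -> 0 < l2norm X ->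
  global_minimizer a b lambda mu X ->
  lambda * l2norm H ^+ 2 <=
    mu * l1norm H + l2norm (quad_meas a X - b) * l2norm (quad_meas a H).
Proof.
move=> U_unit s_ge0 F_gt0 [_ X_min].
have FE := l2norm_spectral_sum U_unit s.
have [t0 t0_gt0 feasible] := descent_weights_feasible F_gt0 s_ge0.
(* The constant [c] is the second-order coefficient left by expanding the squared residual. *)
apply: (le_of_le_add_small (c := 2^-1 * l2norm (quad_meas a H) ^+ 2) t0_gt0).
  by rewrite mulr_ge0 ?invr_ge0 // exprn_ge0 // l2norm_ge0.
move=> t t_gt0 le_t; set h := descent_weights s (l2norm X) in H *.
have t_ge0 := ltW t_gt0.
(* H shares the eigenbasis of X, so X - t H is described by its weights [v], and their signs give
   feasibility. *)
have [v [v_ge0 vE YE]] : exists v : 'rV[R]_d, [/\ forall i, 0 <= v 0 i,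
    forall i, v 0 i = s 0 i - t * h 0 i & spectral_sum U v = X - t%:C *: H].
  exists (s - t *: h); split; first exact: feasible.
    by move=> i; rewrite !mxE.
  by rewrite spectral_sumB spectral_sumZ.
have sum_v : \sum_i v 0 i = \sum_i s 0 i - t * \sum_i h 0 i.
  by rewrite mulr_sumr -sumrB; apply: eq_bigr => i _; rewrite vE.
(* The Frobenius norm is convex, so it lies above its tangent at X; multiplied by the norm of X,
   this is Cauchy-Schwarz for X and X - t H. *)
have lF : l2norm X - t * ((\sum_i s 0 i * h 0 i) / l2norm X) <=
    l2norm (spectral_sum U v).
  rewrite -(ler_pM2l F_gt0); apply: le_trans (spectral_sum_cauchy_schwarz _ _ U_unit).
  rewrite mulrBr -expr2 FE [l2norm X * _]mulrC -mulrA divfK ?gt_eqF //.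
  rewrite mulr_sumr -sumrB le_eqVlt; apply/orP; left; apply/eqP.
  by apply: eq_bigr => i _; rewrite vE; ring.
have l1H : l1norm (spectral_sum U v) <= l1norm X + t * l1norm H.
  rewrite YE -scaleNr; apply: le_trans (l1norm_triangle _ _) _.
  by rewrite l1normZ normcN modulus_real.
have fit : l2norm (quad_meas a (spectral_sum U v) - b) ^+ 2 <=
    (l2norm (quad_meas a X - b) + t * l2norm (quad_meas a H)) ^+ 2.
  rewrite ler_pXn2r ?nnegrE ?addr_ge0 ?mulr_ge0 ?l2norm_ge0 //.
  rewrite YE quad_measB quad_measZ addrAC -scaleNr.
  apply: le_trans (l2norm_triangle _ _) _.
  by rewrite l2normZ normcN modulus_real.
have hE := sum_descent_weights s F_gt0.
rewrite l2norm_spectral_sum // -hE -(ler_pM2l t_gt0).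
exact: (first_order_comparison (objective_spectral_sum s U_unit)
  (objective_spectral_sum v U_unit) (X_min _ (psd_spectral_sum U v_ge0)) sum_v
  (ler_wpM2l lambda_ge0 lF) (ler_wpM2l mu_ge0 l1H) fit).
Qed.

End Minimizer.

(** * Objective values at the two test points, and the rank bound *)

Lemma sqr_noise_bound (R : realFieldType) (c mu l w r : R) :
  c ^+ 2 = 2 * mu -> 0 <= c * l * w ->
  2^-1 * r ^+ 2 <= mu * l ^+ 2 + 2^-1 * w ^+ 2 -> r ^+ 2 <= (c * l + w) ^+ 2.
Proof. by move=> c2; rewrite sqrrD exprMn c2; lra. Qed.

(** An outer product has equal trace and Frobenius norm, so the [lambda] term vanishes, and the
    residual is [- w]. *)
Lemma objective_outer (R : realType) d m (a : 'I_m -> 'cV[R[i]]_d)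
    (x0 : 'cV[R[i]]_d) (w : 'cV[R[i]]_m) (lambda mu : R) :
  objective a (quad_meas a (x0 *m x0^t*) + w) lambda mu (x0 *m x0^t*) =
  mu * l1norm x0 ^+ 2 + 2^-1 * l2norm w ^+ 2.
Proof.
rewrite /objective tr_outer l2norm_outer subrr mulr0 add0r l1norm_outer.
by rewrite opprD addNKr -scaleN1r l2normZ normcN ComplexField.Normc.normc1 mul1r.
Qed.

Lemma objective0 (R : realType) d m (a : 'I_m -> 'cV[R[i]]_d)
    (b : 'cV[R[i]]_m) (lambda mu : R) :
  objective a b lambda mu 0 = 2^-1 * l2norm b ^+ 2.
Proof.
have l2norm0 n p : l2norm (0 : 'M[R[i]]_(n, p)) = 0.
  by rewrite -(scale0r 0) l2normZ ComplexField.Normc.normc0 mul0r.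
rewrite /objective; have -> : quad_meas a 0 = 0.
  by rewrite -(scale0r 0) quad_measZ !scale0r.
have -> : l1norm (0 : 'M[R[i]]_d) = 0.
  by rewrite -(scale0r 0) l1normZ ComplexField.Normc.normc0 mul0r.
rewrite mxtrace0 l2norm0 subr0 /= !mulr0 !add0r.
by rewrite -scaleN1r l2normZ normcN ComplexField.Normc.normc1 mul1r.
Qed.

Theorem lemma1p1 (R : realType) (d m : nat) (a : 'I_m -> 'cV[R[i]]_d)
    (x0 : 'cV[R[i]]_d) (w b : 'cV[R[i]]_m) (lambda mu : R)
    (X : 'M[R[i]]_d)
    (w_real : w \is a realmx)
    (bE : b = quad_meas a (x0 *m x0^t*) + w)
    (X_min : global_minimizer a b lambda mu X)
    (b_large : mu * l1norm x0 ^+ 2 + 2^-1 * l2norm w ^+ 2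
               < 2^-1 * l2norm b ^+ 2)
    (mu_ge0 : 0 <= mu)
    (lambda_large :
       (mu * d%:R
        + opnorm (quad_meas a) * (Num.sqrt (2 * mu) * l1norm x0 + l2norm w))
       / (Num.sqrt 2 - 1) < lambda) :
  \rank X = 1%N.
Proof.
have sqrt2_gt1 : 0 < Num.sqrt 2 - 1 :> R.
  by rewrite subr_gt0 -{1}sqrtr1 ltr_sqrt // ltr1n.
have noise_ge0 : 0 <= Num.sqrt (2 * mu) * l1norm x0 + l2norm w.
  by rewrite addr_ge0 ?mulr_ge0 ?sqrtr_ge0 ?l1norm_ge0 ?l2norm_ge0.
have lambda_ge0 : 0 <= lambda.
  apply/ltW/(le_lt_trans _ lambda_large).
  by rewrite divr_ge0 ?(ltW sqrt2_gt1) // addr_ge0 // mulr_ge0 ?opnorm_ge0.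
have [X_psd X_le] := X_min.
have X_le_outer : objective a b lambda mu X
    <= mu * l1norm x0 ^+ 2 + 2^-1 * l2norm w ^+ 2.
  by have := X_le _ (psd_outer x0); rewrite {2}bE objective_outer.
have X_neq0 : X != 0.
  apply/eqP => X0; move: X_le_outer; rewrite X0 objective0.
  by rewrite leNgt b_large.
have residual : l2norm (quad_meas a X - b)
    <= Num.sqrt (2 * mu) * l1norm x0 + l2norm w.
  rewrite -(@ler_pXn2r _ 2) ?nnegrE ?l2norm_ge0 //.
  have := le_trans (residual_le_objective a b mu_ge0 lambda_ge0 X_psd) X_le_outer.
  (* This is half the cross term in the square of the target bound; being nonnegative, it can be
     added to 2 mu |x0|_1^2 + |w|^2. *)
  have : 0 <= Num.sqrt (2 * mu) * l1norm x0 * l2norm w.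
    by rewrite !mulr_ge0 ?sqrtr_ge0 ?l1norm_ge0 ?l2norm_ge0.
  have : Num.sqrt (2 * mu) ^+ 2 = 2 * mu by rewrite sqr_sqrtr ?mulr_ge0.
  exact: sqr_noise_bound.
apply/eqP; rewrite eqn_leq lt0n mxrank_eq0 X_neq0 andbT.
have [U [s [U_unit s_ge0 XE]]] := psd_spectral_decomposition X_psd.
(* The rank is at most the number of nonzero eigenvalues, so it suffices to exclude two of them. *)
rewrite {1}XE; apply: leq_trans (rank_spectral_sum _ _) _.
rewrite leqNgt; apply/negP => k_gt1.
have X_gt0 : 0 < l2norm X.
  by rewrite lt_def l2norm_ge0 andbT; apply: contra X_neq0 => /eqP/l2norm_eq0 ->.
pose h := descent_weights s (l2norm X); pose H := spectral_sum U h.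
have H_ge : Num.sqrt 2 - 1 <= l2norm H.
  have XEn : l2norm X ^+ 2 = \sum_i s 0 i ^+ 2.
    by rewrite XE l2norm_spectral_sum.
  have := sum_sqr_descent_weights_ge X_gt0 XEn k_gt1.
  by rewrite -(l2norm_spectral_sum U_unit) sqrtr_sqr ger0_norm ?l2norm_ge0.
have H_gt0 := lt_le_trans sqrt2_gt1 H_ge.
have first_order : lambda * l2norm H ^+ 2 <=
    mu * l1norm H + l2norm (quad_meas a X - b) * l2norm (quad_meas a H).
  rewrite /H /h XE; rewrite XE in X_gt0 X_min.
  exact: (stationarity mu_ge0 lambda_ge0 U_unit s_ge0 X_gt0 X_min).
(* It remains to bound [lambda * (Num.sqrt 2 - 1)], hence [lambda * l2norm H], by the numerator.
   Multiplying by [l2norm H > 0] brings in [first_order], whose right side is at most the numerator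
   times [l2norm H]. *)
move: lambda_large; rewrite ltr_pdivrMr // ltNge => /negP; apply.
apply: (le_trans (ler_wpM2l lambda_ge0 H_ge)).
rewrite -(ler_pM2r H_gt0) -mulrA -expr2; apply: (le_trans first_order).
rewrite mulrDl -[mu * _ * _]mulrA lerD ?ler_wpM2l ?l1norm_le_l2norm //.
rewrite mulrAC mulrC ler_pM ?l2norm_ge0 //.
exact: quad_meas_le_opnorm.
Qed.
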